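(* Let $I$ be an arbitrary index set and let $\mu$ be a probability measure on the product $\sigma$-algebra $\bigotimes_{i\in I}\mathcal B(\mathbb R)$ on $\mathbb R^I$, with one-dimensional marginal distributions $\mu_i$, $i\in I$. Then there exists a copula measure $C$ on $\mathbb R^I$ such that for each finite subset $J\subseteq I$, $$F_{C_J}\big((F_{\mu_j}(x_j))_{j\in J}\big)=F_{\mu_J}\big((x_j)_{j\in J}\big)\quad\text{for all }(x_j)_{j\in J}\in\mathbb R^J. \qquad (\ast)$$ Moreover, $C$ is unique if $F_{\mu_i}$ is continuous for each $i\in I$. Conversely, let $C$ be a copula measure on $\mathbb R^I$ and let $(\mu_i)_{i\in I}$ be a family of Borel probability measures on $\mathbb R$. Then there exists a unique probability measure $\mu$ on $\bigotimes_{i\in I}\mathcal B(\mathbb R)$ such that $(\ast)$ holds for every finite $J\subseteq I$ (where $F_{\mu_j}$ denotes the distribution function of the given $\mu_j$).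
   Context: For a measure $\nu$ on $(\mathbb R^I,\bigotimes_{i\in I}\mathcal B(\mathbb R))$ and $J\subseteq I$, $\nu_J:=(\pi_J)_*\nu$ is the pushforward under the coordinate projection $\pi_J:\mathbb R^I\to\mathbb R^J$, and $\nu_i:=\nu_{\{i\}}$. For finite $J$, $F_{\nu_J}$ denotes the cumulative distribution function of $\nu_J$ on $\mathbb R^J$, and $F_{\nu_i}$ that of $\nu_i$. A copula measure on $\mathbb R^I$ is a probability measure $C$ on $\bigotimes_{i\in I}\mathcal B(\mathbb R)$ whose one-dimensional marginals $C_i$ are all uniformly distributed on $[0,1]$. *)

(* Defs.v *)
From HB Require Import structures.
From mathcomp Require Import all_boot all_order all_algebra.
From mathcomp Require Import all_classical all_reals all_analysis.
Set Implicit Arguments. Unset Strict Implicit. Unset Printing Implicit Defensive.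
Import Order.TTheory GRing.Theory Num.Theory.
Import numFieldNormedType.Exports.
Local Open Scope classical_set_scope.
Local Open Scope ring_scope.

(* The carrier R^I, with a pointed (and choice) structure so that the
   generated sigma-algebra construction applies. *)
Definition RIcar (I : Type) (R : realType) := I -> R.
HB.instance Definition _ (I : Type) (R : realType) :=
  gen_eqMixin (RIcar I R).
HB.instance Definition _ (I : Type) (R : realType) :=
  gen_choiceMixin (RIcar I R).
HB.instance Definition _ (I : Type) (R : realType) :=
  isPointed.Build (RIcar I R) (fun _ => 0%R).

Definition cylinders (I : Type) (R : realType) : set (set (RIcar I R)) :=
  [set A | exists (i : I) (B : set R), measurable B /\ A = (fun w => w i) @^-1` B].

Notation RI I R := (g_sigma_algebraType (@cylinders I R)).

(* F_{nu_J}(x) for finite J : the cdf of the finite-dimensional marginal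
   (pi_J)_* nu evaluated at (x_j)_{j in J}, i.e.
   ((pi_J)_* nu) (prod_{j in J} ]-oo, x_j]) = nu {w | forall j in J, w_j <= x_j}.
   Only the values x j for j in J matter. *)
Definition cdfJ (I : Type) (R : realType) (nu : set (RI I R) -> \bar R)
  (J : set I) (x : I -> R) : \bar R :=
  nu [set w : RI I R | forall j, J j -> w j <= x j].

Definition cdf1 (I : Type) (R : realType) (nu : set (RI I R) -> \bar R)
  (i : I) (t : R) : R :=
  fine (nu [set w : RI I R | w i <= t]).

Definition cdfR (R : realType) (nu : set R -> \bar R) (t : R) : R :=
  fine (nu [set s : R | s <= t]).

Definition copula_measure (I : Type) (R : realType) (C : probability (RI I R) R) :=
  forall (i : I) (A : set R), measurable A ->
    C [set w : RI I R | A (w i)] = (@lebesgue_measure R) (A `&` `[0%R, 1%R]).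

(* Main.v *)
(** A single uniform variable V, independent of X ~ mu, smooths all the marginals
    at once: U_i := F_i(X_i-) + V (F_i(X_i) - F_i(X_i-)) is uniform on [0,1], and
    {X_i <= t} is contained in {U_i <= F_i(t)} up to a null set while both have
    probability F_i(t), so the two events agree almost surely.  The law of (U_i)_i
    is therefore the required copula, for any index set and without Kolmogorov's
    extension theorem.  Conversely, the law of (Q_i(W_i))_i, where W ~ C and Q_i is
    the quantile function of nu_i, has the required distribution functions since
    Q_i(u) <= t iff u <= F_i(t).  Uniqueness holds because the boxes
    {w | w_j <= x_j, j in J} form a generating pi-system. *)

Require Import Defs.
From HB Require Import structures.
From mathcomp Require Import all_boot all_order all_algebra.
From mathcomp Require Import all_classical all_reals all_analysis.
From mathcomp Require Import measurable_realfun lra.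
Set Implicit Arguments. Unset Strict Implicit. Unset Printing Implicit Defensive.
Import Order.TTheory GRing.Theory Num.Theory.
Import numFieldNormedType.Exports.
Local Open Scope classical_set_scope.
Local Open Scope ring_scope.

(** * Closed rays and the Borel sets of the line *)

Lemma measurable_le_set (R : realType) (t : R) : measurable [set s : R | s <= t].
Proof. by rewrite -set_itvNyc; exact: measurable_itv. Qed.

Lemma measurable_lt_set (R : realType) (t : R) : measurable [set s : R | s < t].
Proof. by rewrite -set_itvNyo; exact: measurable_itv. Qed.

Lemma measurable_le_preimage d (T : measurableType d) (R : realType)
    (f : T -> R) (t : R) :
  measurable_fun setT f -> measurable [set x | f x <= t].
Proof.
move=> mf; rewrite -[X in measurable X]setTI.
exact: (mf measurableT _ (measurable_le_set t)).
Qed.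

Lemma measurable_lt_preimage d (T : measurableType d) (R : realType)
    (f : T -> R) (t : R) :
  measurable_fun setT f -> measurable [set x | f x < t].
Proof.
move=> mf; rewrite -[X in measurable X]setTI.
exact: (mf measurableT _ (measurable_lt_set t)).
Qed.

Lemma measurable_rays (R : realType) :
  @measurable _ R = <<s [set A : set R | exists t, A = [set s | s <= t]] >>.
Proof.
rewrite -[LHS]/((@ocitv R).-sigma.-measurable) (RGenOInfty.measurableE R).
apply/seteqP; split; apply: smallest_sub; try exact: smallest_sigma_algebra.
- move=> _ [t ->]; rewrite -setCitvl -setTD.
  have [_ + _] := smallest_sigma_algebra setT [set A : set R | exists t, A = [set s | s <= t]].
  by apply; apply: sub_sigma_algebra; exists t; rewrite set_itvNyc.
- move=> _ [t ->]; rewrite -set_itvNyc -setCitvr -setTD.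
  have [_ + _] := smallest_sigma_algebra setT (RGenOInfty.G (R := R)).
  by apply; apply: sub_sigma_algebra; exists t.
Qed.

Lemma measurable_fun_rays d (T : measurableType d) (R : realType) (f : T -> R) :
  (forall t, measurable [set x | f x <= t]) -> measurable_fun setT f.
Proof.
move=> mf; apply: (measurability _ (measurable_rays R)).
by move=> _ [_ [t ->]] <-; rewrite setTI; exact: mf.
Qed.

(** Closed rays form a generating pi-system, and the rays up to [n] exhaust the line, so agreement
    on rays determines a finite measure. *)
Lemma probability_eq_rays (R : realType) (P Q : probability R R) :
  (forall t, P [set s | s <= t] = Q [set s | s <= t]) ->
  forall A : set R, measurable A -> P A = Q A.
Proof.
move=> PQ A; apply: (measure_unique [set A : set R | exists t, A = [set s | s <= t]]
  (fun n : nat => [set s : R | s <= n%:R])).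
- exact: measurable_rays.
- move=> _ _ [s ->] [t ->]; exists (Order.min s t).
  by apply/seteqP; split => x /=; rewrite le_min => /andP.
- by move=> n; exists n%:R.
- rewrite -subTset => x _; exists (Num.truncn x).+1 => //=.
  by rewrite ltW// truncnS_gt.
- by move=> _ [t ->]; exact: PQ.
- by move=> n; rewrite ltey_eq fin_num_measure//; exact: measurable_le_set.
Qed.

(** * Events that agree almost surely *)

Section finite_ae.
Context d (T : measurableType d) (R : realType) (P : probability T R).

Lemma measure_eq_ae (A B : set T) : measurable A -> measurable B ->
  {ae P, forall x, A x <-> B x} -> P A = P B.
Proof.
move=> mA mB [N [mN N0 ABN]].
suff H : forall X Y : set T, measurable X -> measurable Y ->
    (forall x, ~ N x -> X x -> Y x) -> (P X <= P Y)%E.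
  by apply/eqP; rewrite eq_le !H// => x Nx; have /contrapT[AB BA] : ~ ~ (A x <-> B x)
    by move=> /ABN.
move=> X Y mX mY XY; rewrite -[leRHS]adde0 -N0.
apply: le_trans (measureU2 _ mY mN) => //.
apply: le_measure; rewrite ?inE//; first exact: measurableU.
by move=> x Xx; have [|/XY] := pselect (N x); [right|move/(_ Xx); left].
Qed.

(** Finitely many exceptional null sets have a null union. This carries almost sure equivalences
    from single coordinates to finite-dimensional boxes. *)
Lemma measure_eq_bigcap_ae (I : Type) (J : set I) (A B : I -> set T) :
  finite_set J -> (forall j, measurable (A j)) -> (forall j, measurable (B j)) ->
  (forall j, J j -> {ae P, forall x, A j x <-> B j x}) ->
  P (\bigcap_(j in J) A j) = P (\bigcap_(j in J) B j).
Proof.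
move=> fJ mA mB AB; apply: measure_eq_ae.
- exact: fin_bigcap_measurable.
- exact: fin_bigcap_measurable.
(* Finite sets as [{fset}] require a choice structure, which [{classic I}] supplies for an arbitrary
   index type. *)
have [D JD] := (@finite_fsetP {classic I} J).1 fJ.
have : {ae P, forall x, (\bigcap_(j in J) [set x | A j x <-> B j x]) x}.
  rewrite JD; apply: (@filter_bigI _ {classic I}) => j jD; apply: AB.
  by rewrite JD.
apply: filterS => x ABx; split => Hx j Jj.
- by apply/(ABx j Jj)/Hx.
- by apply/(ABx j Jj)/Hx.
Qed.

(** The difference of [B] and [A] has mass P(B) - P(B ∩ A), and P(B ∩ A) = P(A) = P(B) by the almost
    sure inclusion. *)
Lemma ae_eq_of_subset (A B : set T) : measurable A -> measurable B ->
  {ae P, forall x, A x -> B x} -> P A = P B -> {ae P, forall x, A x <-> B x}.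
Proof.
move=> mA mB AB PAB.
have mBA : measurable (B `\` A) by exact: measurableD.
have mAB : measurable (B `&` A) by exact: measurableI.
have BA0 : P (B `\` A) = 0%E.
  have PA : P (B `&` A) = P A.
    apply: measure_eq_ae => //.
    by apply: filterS AB => x AB; split => [[]//|Ax]; split => //; exact: AB.
  rewrite measureD//; last by rewrite ltey_eq fin_num_measure.
  by rewrite [X in (_ - X)%E]PA PAB subee// fin_num_measure.
have : {ae P, forall x, ~ (B `\` A) x}.
  exists (B `\` A); split => // x /=.
  by move/contrapT.
move: AB; apply: filterS2 => x AB nBA; split => [/AB//|Bx].
by apply: contrapT => nA; apply: nBA.
Qed.
End finite_ae.

(** * The uniform law on [0,1] *)

Section uniform01.
Context (R : realType).

Let idR : measurableTypeR R -> R := idfun.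

#[local] HB.instance Definition _ :=
  @isMeasurableFun.Build _ _ _ _ idR (@measurable_id _ _ setT).

(* The library's [uniform_prob] lives on [measurableTypeR R], whose display
   differs from the one of the canonical measurable structure of [R]. *)
Definition uniform01 : probability R R :=
  [the probability _ _ of distribution (uniform_prob (@ltr01 R)) idR].

Lemma uniform01E (A : set R) : measurable A ->
  uniform01 A = lebesgue_measure (A `&` `[0, 1]).
Proof.
move=> mA; rewrite /uniform01/= /distribution /pushforward preimage_id.
rewrite /uniform_prob integral_uniform_pdf.
have mA1 : measurable (A `&` `[0%R, 1%R]%classic) by exact: measurableI.
rewrite (eq_integral (fun=> 1%:E)) ?integral_cst ?mul1e// => x.
by rewrite inE /= in_itv /= /uniform_pdf => -[_ ->]; rewrite subr0 invr1.
Qed.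

End uniform01.

(** * Distribution functions, left limits and quantiles *)

Section distribution_function.
Context (R : realType) (P : probability R R).

(** The left limit F(t-). *)
Definition cdfR_left (t : R) : R := fine (P [set s | s < t]).

Lemma cdfRE t : (cdfR P t)%:E = P [set s | s <= t].
Proof. by rewrite fineK// fin_num_measure//; exact: measurable_le_set. Qed.

Lemma cdfR_leftE t : (cdfR_left t)%:E = P [set s | s < t].
Proof. by rewrite fineK// fin_num_measure//; exact: measurable_lt_set. Qed.

Lemma cdfR_nondecreasing : {homo cdfR P : s t / s <= t}.
Proof.
move=> s t st; rewrite -lee_fin !cdfRE.
apply: le_measure; rewrite ?inE; do ?exact: measurable_le_set.
by move=> x /= /le_trans; exact.
Qed.

Lemma cdfR_left_nondecreasing : {homo cdfR_left : s t / s <= t}.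
Proof.
move=> s t st; rewrite -lee_fin !cdfR_leftE.
apply: le_measure; rewrite ?inE; do ?exact: measurable_lt_set.
by move=> x /= /lt_le_trans; exact.
Qed.

Lemma cdfR_left_le t : cdfR_left t <= cdfR P t.
Proof.
rewrite -lee_fin cdfR_leftE cdfRE.
apply: le_measure; rewrite ?inE; [exact: measurable_lt_set|exact: measurable_le_set|].
by move=> x /= /ltW.
Qed.

Lemma cdfR_le_left s t : s < t -> cdfR P s <= cdfR_left t.
Proof.
move=> st; rewrite -lee_fin cdfR_leftE cdfRE.
apply: le_measure; rewrite ?inE; [exact: measurable_le_set|exact: measurable_lt_set|].
by move=> x /= /le_lt_trans; exact.
Qed.

Lemma cdfR_ge0 t : 0 <= cdfR P t.
Proof. by rewrite fine_ge0. Qed.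

Lemma cdfR_le1 t : cdfR P t <= 1.
Proof. by rewrite -lee_fin cdfRE probability_le1//; exact: measurable_le_set. Qed.

Lemma cdfR_atom t : P [set t] = (cdfR P t - cdfR_left t)%:E.
Proof.
have -> : [set t] = [set s | s <= t] `\` [set s | s < t].
  apply/seteqP; split => x /=; first by move=> ->; rewrite lexx ltxx.
  by move=> [xt /negP]; rewrite -leNgt => tx; apply/eqP; rewrite eq_le xt.
have mle := measurable_le_set t; have mlt := measurable_lt_set t.
rewrite measureD//; last by rewrite ltey_eq fin_num_measure.
rewrite setIidr; last by move=> x /= /ltW.
by rewrite EFinB cdfRE cdfR_leftE.
Qed.

(** Under [P] the identity is a random variable with law [P]; its [cdf] brings the limits at
    infinity and right continuity. *)
Let idRV : R -> R := idfun.

#[local] HB.instance Definition _ :=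
  @isMeasurableFun.Build _ _ _ _ idRV (@measurable_id _ _ setT).

Let cdfR_cdf : cdfR P = fine \o cdf (idRV : {RV P >-> R}).
Proof.
by apply/funext => t; rewrite /cdfR /= /cdf set_itvNyc.
Qed.

Lemma cdfR_gt u : u < 1 -> exists t, u < cdfR P t.
Proof.
move=> u1; have : cdfR P @ +oo --> (1:R).
  by rewrite cdfR_cdf; exact/fine_cvg/cvg_cdfy1.
move/cvgr_gt => /(_ _ u1) Fu.
near (pinfty_nbhs R) => t; exists t; near: t; exact: Fu.
Unshelve. all: by end_near. Qed.

Lemma cdfR_lt u : 0 < u -> exists t, cdfR P t < u.
Proof.
move=> u0; have : cdfR P @ -oo --> (0:R).
  by rewrite cdfR_cdf; exact/fine_cvg/cvg_cdfNy0.
move/cvgr_lt => /(_ _ u0) Fu.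
near (ninfty_nbhs R) => t; exists t; near: t; exact: Fu.
Unshelve. all: by end_near. Qed.

Lemma cdfR_ge_right u t : (forall s, t < s -> u <= cdfR P s) -> u <= cdfR P t.
Proof.
move=> ut; have Ft : cdfR P s @[s --> t^'+] --> cdfR P t.
  rewrite cdfR_cdf; apply: fine_cvg => /=.
  by rewrite fineK ?fin_num_measure//; exact: cdf_right_continuous.
apply: (cvgr_to_ge Ft); near=> s; apply: ut; near: s; exact: nbhs_right_gt.
Unshelve. all: by end_near. Qed.

(** The open ray below [q] is the increasing union of the closed rays ending at q - 1/(n+1), so
    continuity from below applies. *)
Lemma cdfR_left_le_of u q : (forall s, s < q -> cdfR P s <= u) -> cdfR_left q <= u.
Proof.
move=> qu; rewrite -lee_fin cdfR_leftE.
pose A (n : nat) := [set s : R | s <= q - n.+1%:R^-1].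
have mA n : measurable (A n) by exact: measurable_le_set.
have -> : [set s | s < q] = \bigcup_n A n.
  apply/seteqP; split => s /=.
    rewrite -subr_gt0 => /ltr_add_invr[k]; rewrite add0r => ks.
    by exists k => //=; rewrite /A/= lerBrDl -lerBrDr ltW.
  move=> [n _ /le_lt_trans]; apply.
  by rewrite ltrBlDr ltrDl invr_gt0.
have : P (A n) @[n --> \oo] --> P (\bigcup_n A n).
  apply: nondecreasing_cvg_mu => //; first exact: bigcup_measurable.
  move=> m n mn; apply/subsetPset => s /= /le_trans; apply.
  by rewrite lerD2l lerN2 lef_pV2 ?posrE// ler_nat.
move/cvge_to_le; apply; apply: nearW => n.
rewrite -cdfRE lee_fin; apply: qu.
by rewrite ltrBlDr ltrDl invr_gt0.
Qed.

(** The generalised inverse of F; for [0 < u < 1] the set is nonempty and bounded below. *)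
Definition quantile (u : R) : R := inf [set t | u <= cdfR P t].

(** Right continuity makes the infimum attained, which yields a Galois connection between [quantile]
    and [cdfR P]. *)
Lemma quantile_le u t : 0 < u < 1 -> (quantile u <= t) = (u <= cdfR P t).
Proof.
(* [a] will bound the defining set from below and [b] belongs to it, so the infimum is genuine. *)
move=> /andP[u0 u1]; have [a au] := cdfR_lt u0; have [b ub] := cdfR_gt u1.
have lbS : has_lbound [set t | u <= cdfR P t].
  exists a => s /= us; rewrite leNgt; apply/negP => sa.
  have /(le_trans us) := cdfR_nondecreasing (ltW sa).
  by rewrite leNgt au.
apply/idP/idP => [qt|ut]; last exact: ge_inf.
apply: cdfR_ge_right => s ts.
have [] := @inf_lt _ [set t | u <= cdfR P t] s.
- by exists b; exact: ltW.
- exact: le_lt_trans ts.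
- by move=> r /= ur rs; rewrite (le_trans ur)// cdfR_nondecreasing// ltW.
Qed.

Lemma quantile_gt u t : 0 < u < 1 -> (t < quantile u) = (cdfR P t < u).
Proof. by move=> u01; rewrite !ltNge quantile_le. Qed.

Lemma cdfR_quantile_ge u : 0 < u < 1 -> u <= cdfR P (quantile u).
Proof. by move=> u01; rewrite -quantile_le. Qed.

Lemma cdfR_left_quantile_le u : 0 < u < 1 -> cdfR_left (quantile u) <= u.
Proof.
by move=> u01; apply: cdfR_left_le_of => s; rewrite quantile_gt// => /ltW.
Qed.

(** Left of the quantile F stays below [u]; continuity carries this bound to the quantile itself. *)
Lemma cdfR_quantile u : continuous (cdfR P) -> 0 < u < 1 ->
  cdfR P (quantile u) = u.
Proof.
move=> cF u01; apply/eqP; rewrite eq_le cdfR_quantile_ge// andbT.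
have Fq : cdfR P s @[s --> (quantile u)^'-] --> cdfR P (quantile u).
  by apply: cvg_at_left_filter; exact: cF.
apply: (cvgr_to_le Fq); near=> s; apply: ltW; rewrite -quantile_gt//.
Unshelve. all: by end_near. Qed.

(** On ]0,1[ the Galois connection describes the sublevel sets; outside, the default value 0 leaves
    everything or nothing. *)
Lemma measurable_quantile01 :
  measurable_fun setT (fun u : R => if 0 < u < 1 then quantile u else 0).
Proof.
apply: measurable_fun_rays => t.
have -> : [set u | (if 0 < u < 1 then quantile u else 0) <= t] =
  ([set` `]0, 1[] `&` [set u | u <= cdfR P t]) `|`
  (~` [set` `]0, 1[] `&` [set u | 0 <= t]).
  apply/seteqP; split => u /=; rewrite in_itv/=; case: ifPn => u01.
  - by rewrite quantile_le//; left.
  - by right; split => //; exact/negP.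
  - by rewrite quantile_le// => -[[]//|[]//].
  - by move=> [[]//|[]//].
apply: measurableU; apply: measurableI => //; first exact: measurable_le_set.
- exact: measurableC.
- have [t0|t0] := leP 0 t.
  + by rewrite (_ : [set _ | _] = setT)//; apply/seteqP.
  + by rewrite (_ : [set _ | _] = set0)//; apply/seteqP; split => // x.
Qed.

End distribution_function.

(** * Recognising the uniform law *)

Section uniform_law.
Context (R : realType).
Local Notation V := (uniform01 R).

Lemma uniform01_le (c : R) : 0 <= c <= 1 -> V [set v | v <= c] = c%:E.
Proof.
move=> /andP[c0 c1].
rewrite uniform01E; last exact: measurable_le_set.
rewrite (_ : _ `&` _ = `[0, c]%classic); last first.
  apply/seteqP; split => x /=; rewrite !in_itv/=; first by move=> [-> /andP[->]].
  by move=> /andP[x0 xc]; split => //; rewrite x0 (le_trans xc).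
rewrite lebesgue_measure_itv/= lte_fin; case: ltP => [_|c0'].
  by rewrite -EFinB subr0.
by congr (_%:E); apply/eqP; rewrite eq_le c0 c0'.
Qed.

Lemma uniform01_itvC : V (~` `[0, 1]) = 0%E.
Proof. by rewrite uniform01E ?setICl ?measure0//; exact: measurableC. Qed.

Let sandwich_cdf (W : probability R R) :
  (forall u, 0 < u < 1 -> cdfR_left W u <= u <= cdfR W u) ->
  forall t, cdfR W t = if t <= 0 then 0 else if t < 1 then t else 1.
Proof.
move=> HW t; have x0 := cdfR_ge0 W t; have x1 := cdfR_le1 W t.
have up u : t < u -> 0 < u < 1 -> cdfR W t <= u.
  move=> tu /HW /andP[+ _]; apply: le_trans; exact: cdfR_le_left.
have lo u : u <= t -> 0 < u < 1 -> u <= cdfR W t.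
  move=> ut /HW /andP[_]; move=> /le_trans; apply; exact: cdfR_nondecreasing.
move: x0 x1 up lo; set x := cdfR W t => x0 x1 up lo.
(* Each strict inequality is refuted at a midpoint in ]0,1[: between 0 and [x], [t] and [x], or [x]
   and 1. *)
have [t0|t0] := leP t 0; last (have [t1|t1] := ltP t 1); apply/eqP; rewrite eq_le.
- rewrite x0 andbT leNgt; apply/negP => xp.
  have := up (x / 2); lra.
- apply/andP; split; last by apply: lo; lra.
  rewrite leNgt; apply/negP => xp; have := up ((t + x) / 2); lra.
- rewrite x1/= leNgt; apply/negP => xp; have := lo ((1 + x) / 2); lra.
Qed.

(** The hypothesis asks only for inequalities, so it can be checked by covering one event and
    filling another. *)
Lemma eq_uniform01 (W : probability R R) :
  (forall u, 0 < u < 1 -> cdfR_left W u <= u <= cdfR W u) ->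
  forall A : set R, measurable A -> W A = V A.
Proof.
move=> HW; apply: probability_eq_rays => t.
rewrite -!cdfRE; congr (_%:E); rewrite (sandwich_cdf HW) sandwich_cdf// => u u01.
(* The uniform law satisfies the sandwich too, so both laws have the same explicit distribution
   function. *)
have -> : cdfR V u = u.
  by apply: EFin_inj; rewrite cdfRE uniform01_le//; lra.
rewrite lexx andbT (le_trans (cdfR_left_le _ _))//.
by rewrite -lee_fin cdfRE uniform01_le//; lra.
Qed.

End uniform_law.

(** * The distributional transform *)

Section distributional_transform.
Context d (T : measurableType d) (R : realType) (mu : probability T R).
Variable X : {mfun T >-> R}.
Let P : probability R R := [the probability _ _ of distribution mu X].
Local Notation V := (uniform01 R).
Let M : probability (T * R)%type R := [the probability _ _ of (mu \x V)%E].

(** [z.2] spreads the mass of an atom evenly over the jump of the distribution function there. *)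
Definition dtransform (z : T * R) : R :=
  cdfR_left P (X z.1) + z.2 * (cdfR P (X z.1) - cdfR_left P (X z.1)).

Lemma measurable_dtransform : measurable_fun setT dtransform.
Proof.
have mX : measurable_fun setT (fun z : T * R => X z.1).
  exact: measurableT_comp.
have mF : measurable_fun setT (fun z : T * R => cdfR P (X z.1)).
  apply: (measurableT_comp _ mX).
  by apply: nondecreasing_measurable => // s t; exact: cdfR_nondecreasing.
have mL : measurable_fun setT (fun z : T * R => cdfR_left P (X z.1)).
  apply: (measurableT_comp _ mX).
  by apply: nondecreasing_measurable => // s t; exact: cdfR_left_nondecreasing.
by apply: measurable_funD => //; apply: measurable_funM => //; exact: measurable_funB.
Qed.

#[local] HB.instance Definition _ :=
  @isMeasurableFun.Build _ _ _ _ dtransform measurable_dtransform.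

Lemma dtransform_le_cdf z : z.2 <= 1 -> dtransform z <= cdfR P (X z.1).
Proof.
by move=> v1; rewrite /dtransform; have := cdfR_left_le P (X z.1); nra.
Qed.

Lemma dtransform_ge_left z : 0 <= z.2 -> cdfR_left P (X z.1) <= dtransform z.
Proof.
by move=> v0; rewrite /dtransform; have := cdfR_left_le P (X z.1); nra.
Qed.

Let mX A : measurable A -> measurable (X @^-1` A).
Proof. by move=> mA; rewrite -[X in measurable X]setTI; exact: measurable_funP. Qed.

Let MX (A : set T) (B : set R) : measurable A -> measurable B ->
  M (A `*` B) = (mu A * V B)%E.
Proof. exact: product_measure1E. Qed.

Let W : probability R R := [the probability _ _ of distribution M dtransform].

(** With [q] the [u]-quantile, the events X < q and (X = q, V <= c) are disjoint of total mass [u].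
    Up to null sets, their union contains {dtransform < u} and lies in {dtransform <= u}. *)
Let sandwich u : 0 < u < 1 -> cdfR_left W u <= u <= cdfR W u.
Proof.
move=> u01; pose q := quantile P u.
have Fq : u <= cdfR P q by exact: cdfR_quantile_ge.
have Lq : cdfR_left P q <= u by exact: cdfR_left_quantile_le.
(* [c = 0] when [q] is not an atom, since then the denominator vanishes; in
   that case [u = cdfR_left P q], so [cE] holds all the same. *)
pose c := (u - cdfR_left P q) / (cdfR P q - cdfR_left P q).
have cE : c * (cdfR P q - cdfR_left P q) = u - cdfR_left P q.
  rewrite /c; have [D0|D0] := eqVneq (cdfR P q - cdfR_left P q) 0; last by rewrite divfK.
  by rewrite D0 mulr0; lra.
have c01 : 0 <= c <= 1.
  have [D0|D0] := eqVneq (cdfR P q - cdfR_left P q) 0.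
    by rewrite /c D0 invr0 mulr0 lexx ler01.
  have Dp : 0 < cdfR P q - cdfR_left P q by rewrite lt_neqAle eq_sym D0/=; lra.
  by rewrite divr_ge0 ?ler_pdivrMr ?(ltW Dp)//=; lra.
have mlt : measurable (X @^-1` [set s | s < q]) by apply: mX; exact: measurable_lt_set.
have meq : measurable (X @^-1` [set q]) by apply: mX.
have mc : measurable [set v : R | v <= c] by exact: measurable_le_set.
have mI : measurable (~` `[0, 1] : set R) by exact: measurableC.
have Meq : M (X @^-1` [set q] `*` [set v | v <= c]) = (u - cdfR_left P q)%:E.
  rewrite MX// uniform01_le//.
  by rewrite -[mu _]/(P [set q]) cdfR_atom -EFinM mulrC cE.
apply/andP; split; rewrite -lee_fin ?cdfRE ?cdfR_leftE.
- rewrite -[W _]/(M [set z | dtransform z < u]).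
  pose A1 := X @^-1` [set s | s < q] `*` [set: R].
  pose A2 := X @^-1` [set q] `*` [set v | v <= c].
  (* For V outside [0,1] the transform may leave the jump interval, so this null slab joins the
     cover. *)
  pose A3 := [set: T] `*` (~` `[0, 1] : set R).
  have mA1 : measurable A1 by exact: measurableX.
  have mA2 : measurable A2 by exact: measurableX.
  have mA3 : measurable A3 by exact: measurableX.
  have MA1 : M A1 = (cdfR_left P q)%:E.
    rewrite MX//.
    by rewrite (probability_setT V) mule1 cdfR_leftE.
  have MA3 : M A3 = 0%E by rewrite MX// uniform01_itvC mule0.
  apply: (@le_trans _ _ (M (A1 `|` A2 `|` A3))).
    apply: le_measure; rewrite ?inE.
    + by apply: measurable_lt_preimage; exact: measurable_dtransform.
    + by do 2?apply: measurableU.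
    move=> [x v]/= Yu.
    have [|v01] := pselect ((~` `[0, 1] : set R) v); first by right.
    left; move/contrapT : v01; rewrite /= in_itv/= => /andP[v0 v1].
    have [xq|qx|xq] := ltgtP (X x) q.
    + by left.
    (* Here the transform is at least F(X-) >= F(q) >= u, a contradiction. *)
    + have := dtransform_ge_left (z := (x, v)) v0 => /=.
      by have := cdfR_le_left P qx; lra.
    (* With D >= 0 the jump at [q], v D < u - F(q-) = c D. *)
    + right; split => //=; move: Yu; rewrite /dtransform/= xq; nra.
  apply: (@le_trans _ _ (M (A1 `|` A2) + M A3)%E).
    exact: (measureU2 _ (measurableU _ _ mA1 mA2) mA3).
  rewrite MA3 adde0; apply: (@le_trans _ _ (M A1 + M A2)%E).
    exact: (measureU2 _ mA1 mA2).
  by rewrite MA1 Meq -EFinD lee_fin; lra.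
- rewrite -[W _]/(M [set z | dtransform z <= u]).
  (* On [0,1] the transform is at most F(X), and F(X) < u left of [q]. *)
  pose A1 := X @^-1` [set s | s < q] `*` (`[0, 1] : set R).
  pose A2 := X @^-1` [set q] `*` [set v | v <= c].
  have mA1 : measurable A1 by exact: measurableX.
  have mA2 : measurable A2 by exact: measurableX.
  have MA1 : M A1 = (cdfR_left P q)%:E.
    rewrite MX// uniform01E// setIid.
    by rewrite lebesgue_measure_itv/= lte_fin ltr01 oppr0 adde0 mule1 cdfR_leftE.
  have -> : u%:E = (M A1 + M A2)%E.
    by rewrite MA1 Meq -EFinD; congr (_%:E); lra.
  have A12 : A1 `&` A2 = set0.
    by apply/seteqP; split => // -[x v] [[/= xq _] [/= Xq _]]; move: xq; rewrite Xq ltxx.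
  rewrite -(measureU M mA1 mA2 A12).
  apply: le_measure; rewrite ?inE.
  + exact: measurableU.
  + by apply: measurable_le_preimage; exact: measurable_dtransform.
  move=> [x v]/= [[/= xq]|[/= xq vc]].
    rewrite in_itv/= => /andP[v0 v1].
    apply: le_trans (dtransform_le_cdf (z := (x, v)) v1) _ => /=.
    by apply: ltW; rewrite -quantile_gt.
  by rewrite /dtransform/= xq; nra.
Qed.

Lemma dtransform_uniform (A : set R) : measurable A ->
  (mu \x V)%E (dtransform @^-1` A) = V A.
Proof. by move=> mA; rewrite -(eq_uniform01 sandwich mA). Qed.

Lemma dtransform_le_ae t :
  {ae (mu \x V)%E, forall z, X z.1 <= t <-> dtransform z <= cdfR P t}.
Proof.
have mle : measurable (X @^-1` [set s | s <= t]) by apply: mX; exact: measurable_le_set.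
apply: (ae_eq_of_subset (P := M) (A := [set z | X z.1 <= t])
  (B := [set z | dtransform z <= cdfR P t])).
- by apply: measurable_le_preimage; exact: measurableT_comp.
- by apply: measurable_le_preimage; exact: measurable_dtransform.
(* Monotonicity of F gives the inclusion as soon as [z.2] lies in [0,1]. *)
- exists ([set: T] `*` (~` `[0, 1] : set R)); split.
  + by apply: measurableX => //; exact: measurableC.
  + rewrite MX//; last exact: measurableC.
    by rewrite uniform01_itvC mule0.
  + move=> [x v] /= nAB; split => //= v01; apply: nAB => /= xt.
    move: v01; rewrite in_itv/= => /andP[v0 v1].
    apply: le_trans (dtransform_le_cdf (z := (x, v)) v1) _ => /=.
    exact: cdfR_nondecreasing.
- have -> : [set z | X z.1 <= t] = X @^-1` [set s | s <= t] `*` [set: R].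
    by apply/seteqP; split => -[x v]//= [].
  rewrite MX// (probability_setT V) mule1.
  transitivity (V [set s | s <= cdfR P t]).
    by rewrite uniform01_le ?cdfR_ge0 ?cdfR_le1// cdfRE.
  apply/esym/(dtransform_uniform (A := [set s | s <= cdfR P t])).
  exact: measurable_le_set.
Qed.

End distributional_transform.

(** * Boxes in the product space *)

Section product_space.
Context (I : Type) (R : realType).

Definition coord (i : I) : RI I R -> R := fun w => w i.

Lemma measurable_coord i : measurable_fun setT (coord i).
Proof.
by move=> _ B mB; rewrite setTI; apply: sub_sigma_algebra; exists i, B.
Qed.

HB.instance Definition _ i :=
  @isMeasurableFun.Build _ _ _ _ (coord i) (measurable_coord i).

Lemma measurable_fun_RI d (T : measurableType d) (f : T -> RI I R) :
  (forall i, measurable_fun setT (fun x => f x i)) -> measurable_fun setT f.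
Proof.
move=> mf; apply: (@measurability _ _ T (RI I R) setT f (@cylinders I R)) => //.
move=> _ [_ [i [B [mB ->]]] <-]; rewrite setTI.
by have := mf i measurableT _ mB; rewrite setTI.
Qed.

(** [cdfJ nu J x] is [nu (box J x)] by conversion. *)
Definition box (J : set I) (x : I -> R) : set (RI I R) :=
  [set w | forall j, J j -> w j <= x j].

Lemma boxE J x : box J x = \bigcap_(j in J) [set w | w j <= x j].
Proof. by []. Qed.

Lemma measurable_coord_le i t : measurable [set w : RI I R | w i <= t].
Proof. by apply: (measurable_le_preimage (f := coord i)); exact: measurable_coord. Qed.

Lemma measurable_box J x : finite_set J -> measurable (box J x).
Proof.
by move=> fJ; apply: fin_bigcap_measurable => // j _; exact: measurable_coord_le.
Qed.

Lemma box0 x : box set0 x = setT.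
Proof. by apply/seteqP; split => // w _ j []. Qed.

Let boxes := [set A | exists J x, finite_set J /\ A = box J x].

Let boxes_setI : setI_closed boxes.
Proof.
move=> _ _ [J [x [fJ ->]]] [K [y [fK ->]]].
(* Common indices get the smaller of the two bounds; [pselect] decides membership in arbitrary
   sets. *)
exists (J `|` K), (fun j => if pselect (J j) then
  (if pselect (K j) then Order.min (x j) (y j) else x j) else y j).
split; first by rewrite finite_setU.
apply/seteqP; split => [w [wJ wK] j JKj|w wJK].
  case: pselect => Jj; last by case: JKj => // Kj; exact: wK.
  by case: pselect => Kj; rewrite ?le_min wJ// wK.
split => j Hj.
  have := wJK j (or_introl Hj); case: pselect => //= Jj; case: pselect => //= Kj.
  by rewrite le_min => /andP[].
have := wJK j (or_intror Hj); case: pselect => //= Jj; case: pselect => //= Kj.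
by rewrite le_min => /andP[].
Qed.

(** Boxes on one index are preimages of closed rays, which already make every coordinate
    measurable. *)
Let measurable_boxes : @measurable _ (RI I R) = <<s boxes >>.
Proof.
apply/seteqP; split; apply: smallest_sub; try exact: smallest_sigma_algebra.
- move=> _ [i [B [mB ->]]].
  have mi : measurable_fun setT (fun w : g_sigma_algebraType boxes => w i).
    apply: measurable_fun_rays => t; apply: sub_sigma_algebra.
    exists [set i], (fun=> t); split; first exact: finite_set1.
    by apply/seteqP; split => [w wt j ->//|w]; exact.
  by have := mi measurableT _ mB; rewrite setTI.
- by move=> _ [J [x [fJ ->]]]; exact: measurable_box.
Qed.

Lemma probability_eq_cdfJ (P Q : probability (RI I R) R) :
  (forall J, finite_set J -> forall x, cdfJ P J x = cdfJ Q J x) ->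
  forall A : set (RI I R), measurable A -> P A = Q A.
Proof.
(* The whole space is the box on the empty index set and has finite mass, so a constant exhaustion
   suffices. *)
move=> PQ A; apply: (measure_unique boxes (fun=> setT)) => //.
- by move=> _; exists set0, (fun=> 0); rewrite box0.
- by apply/seteqP; split => // w _; exists 0%N.
- by move=> _ [J [x [fJ ->]]]; exact: PQ.
- by move=> _; rewrite ltey_eq fin_num_measure.
Qed.

End product_space.

(** * Values of a copula measure on boxes *)

Section copula.
Context (I : Type) (R : realType) (C : probability (RI I R) R).
Hypothesis copC : copula_measure C.

Lemma copula_coord_le i t : C [set w | w i <= t] = uniform01 R [set v | v <= t].
Proof.
rewrite uniform01E; last exact: measurable_le_set.
by rewrite (copC i (A := [set v | v <= t]))//; exact: measurable_le_set.
Qed.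

Lemma copula_ae_coord i (A : set R) : measurable A ->
  lebesgue_measure (~` A `&` `[0, 1]) = 0%E -> {ae C, forall w, A (w i)}.
Proof.
move=> mA A0; have mCA : measurable (~` A) by exact: measurableC.
exists [set w : RI I R | (~` A) (w i)]; split => //.
- by have := @measurable_coord I R i measurableT _ mCA; rewrite setTI.
- by rewrite -A0; exact: copC.
Qed.

(** The endpoints 0 and 1 are null; quantiles are controlled only strictly between them. *)
Lemma copula_ae_coord_oo i : {ae C, forall w : RI I R, 0 < w i < 1}.
Proof.
have mo : measurable (`]0, 1[ : set R) by [].
have : {ae C, forall w : RI I R, (`]0, 1[%classic : set R) (w i)}.
  apply: copula_ae_coord => //.
  rewrite (_ : _ `&` _ = [set 0; 1]).
    apply: countable_lebesgue_measure0; apply: finite_set_countable.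
    by rewrite finite_setU; split; exact: finite_set1.
  apply/seteqP; split => v /=; rewrite !in_itv/=; last first.
    by move=> [] ->; rewrite ?ltxx ?lexx ?ler01 ?andbF.
  move=> [/negP v01 /andP[v0 v1]]; move: v01; rewrite negb_and -!leNgt.
  by case/orP => h; [left|right]; apply/eqP; rewrite eq_le h ?v0 ?v1.
by apply: filterS => w /=; rewrite in_itv.
Qed.

Lemma copula_box_eq0 (J : set I) (u : I -> R) j : finite_set J -> J j ->
  u j <= 0 -> C (box J u) = 0%E.
Proof.
move=> fJ Jj uj; apply: (subset_measure0 (B := [set w : RI I R | w j <= 0])).
- exact: measurable_box.
- exact: measurable_coord_le.
- by move=> w /(_ _ Jj) /le_trans; exact.
- by apply: (etrans (copula_coord_le j 0)); rewrite uniform01_le ?lexx ?ler01.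
Qed.

(** Coordinates are almost surely below 1, so a bound [u j >= 1] is almost surely no constraint. *)
Lemma copula_box_lt1 (J : set I) (u : I -> R) : finite_set J ->
  C (box J u) = C (box (J `&` [set j | u j < 1]) u).
Proof.
move=> fJ.
(* Padding with the trivial event [setT] puts both intersections over the same [J], ready for
   comparison index by index. *)
have -> : box (J `&` [set j | u j < 1]) u =
    \bigcap_(j in J) (if u j < 1 then [set w : RI I R | w j <= u j] else setT).
  apply/seteqP; split => w wJ j.
    by move=> Jj; case: ifPn => //= uj; exact: wJ.
  by move=> [Jj uj]; have := wJ j Jj; rewrite uj.
rewrite boxE; apply: measure_eq_bigcap_ae => //.
- by move=> j; exact: measurable_coord_le.
- by move=> j; case: ifPn => // _; exact: measurable_coord_le.
move=> j Jj; case: ltP => uj; first exact: aeW.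
have := copula_ae_coord_oo j; apply: filterS => w /andP[_ w1].
by split => // _ /=; rewrite (le_trans (ltW w1)).
Qed.

End copula.

(** * Uniqueness and existence of copulas, and the converse *)

Lemma copula_unique (I : Type) (R : realType) (mu C1 C2 : probability (RI I R) R) :
  (forall i, continuous (cdf1 mu i)) -> copula_measure C1 -> copula_measure C2 ->
  (forall J, finite_set J -> forall x,
     cdfJ C1 J (fun j => cdf1 mu j (x j)) = cdfJ mu J x) ->
  (forall J, finite_set J -> forall x,
     cdfJ C2 J (fun j => cdf1 mu j (x j)) = cdfJ mu J x) ->
  forall A : set (RI I R), measurable A -> C1 A = C2 A.
Proof.
move=> cF cop1 cop2 H1 H2; apply: probability_eq_cdfJ => J fJ u.
rewrite -[LHS]/(C1 (box J u)) -[RHS]/(C2 (box J u)).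
have [[j Jj uj]|u0] := pselect (exists2 j, J j & u j <= 0).
  by rewrite !(copula_box_eq0 _ fJ Jj).
rewrite (copula_box_lt1 cop1)// (copula_box_lt1 cop2)//; set K := J `&` _.
have fK : finite_set K by exact: finite_setIl.
pose P j : probability R R := [the probability _ _ of distribution mu (coord j)].
pose x j := quantile (P j) (u j).
(* Continuity makes every level in ]0,1[ a value of the marginal distribution function, so the
   measure of the box is prescribed by [mu]. *)
have FxE j : K j -> cdf1 mu j (x j) = u j.
  move=> [Jj uj1]; apply: (@cdfR_quantile _ (P j)); first exact: cF.
  by rewrite uj1 andbT ltNge; apply/negP => uj0; apply: u0; exists j.
have boxK : box K u = box K (fun j => cdf1 mu j (x j)).
  by apply/seteqP; split => w wK j Kj; move: (wK j Kj); rewrite FxE.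
by rewrite boxK; transitivity (cdfJ mu K x); [exact: H1|exact/esym/H2].
Qed.

Lemma copula_exists (I : Type) (R : realType) (mu : probability (RI I R) R) :
  exists C : probability (RI I R) R, copula_measure C /\
    forall J, finite_set J -> forall x,
      cdfJ C J (fun j => cdf1 mu j (x j)) = cdfJ mu J x.
Proof.
pose Phi : RI I R * R -> RI I R := fun z i => dtransform mu (coord i) z.
have mPhi : measurable_fun setT Phi.
  by apply: measurable_fun_RI => i; exact: measurable_dtransform.
pose PhiM := HB.pack_for {mfun (RI I R * R)%type >-> RI I R} Phi
  (isMeasurableFun.Build _ _ _ _ Phi mPhi).
pose M : probability (RI I R * R)%type R := [the probability _ _ of (mu \x uniform01 R)%E].
exists [the probability _ _ of distribution M PhiM]; split.
  move=> i A mA; rewrite -uniform01E//.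
  exact: (dtransform_uniform mu (coord i) mA).
move=> J fJ x.
transitivity (M (\bigcap_(j in J) [set z | dtransform mu (coord j) z <= cdf1 mu j (x j)])).
  by [].
transitivity (M (\bigcap_(j in J) [set z | coord j z.1 <= x j])).
  apply: measure_eq_bigcap_ae => //.
  - by move=> j; apply: measurable_le_preimage; exact: measurable_dtransform.
  - by move=> j; apply: measurable_le_preimage; exact: measurableT_comp.
  (* [cdf1 mu j] is, by conversion, [cdfR] of the law of [coord j]. *)
  - move=> j _; have := dtransform_le_ae mu (coord j) (x j).
    by apply: filterS => z [? ?]; split.
transitivity (M (box J x `*` [set: R])).
  congr (M _); apply/seteqP; split => -[w v]; first by move=> wJ; split.
  by move=> [].
have mJ := measurable_box x fJ.
rewrite /M/= product_measure1E//.
by rewrite [X in (_ * X)%E](probability_setT (uniform01 R)) mule1.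
Qed.

Lemma sklar_converse_exists (I : Type) (R : realType)
    (C : probability (RI I R) R) (nu : I -> probability R R) :
  copula_measure C ->
  exists mu : probability (RI I R) R,
    forall J, finite_set J -> forall x,
      cdfJ C J (fun j => cdfR (nu j) (x j)) = cdfJ mu J x.
Proof.
move=> copC.
pose q i (u : R) := if 0 < u < 1 then quantile (nu i) u else 0.
pose Q : RI I R -> RI I R := fun w i => q i (w i).
have mQi i : measurable_fun setT (fun w : RI I R => q i (w i)).
  apply: (measurableT_comp (measurable_quantile01 (nu i))).
  exact: measurable_coord.
have mQ : measurable_fun setT Q by exact: measurable_fun_RI.
pose QM := HB.pack_for {mfun RI I R >-> RI I R} Q
  (isMeasurableFun.Build _ _ _ _ Q mQ).
exists [the probability _ _ of distribution C QM] => J fJ x.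
transitivity (C (\bigcap_(j in J) [set w | w j <= cdfR (nu j) (x j)])) => //.
transitivity (C (\bigcap_(j in J) [set w | q j (w j) <= x j])) => //.
apply: measure_eq_bigcap_ae => //.
- by move=> j; exact: measurable_coord_le.
- by move=> j; apply: measurable_le_preimage; exact: mQi.
(* Almost surely [w j] lies in ]0,1[, where [q j] is the quantile rather than the default 0. *)
move=> j _; have := copula_ae_coord_oo copC j; apply: filterS => w w01.
by rewrite /= /q w01 quantile_le.
Qed.

Theorem theorem2p3 (R : realType) (I : Type) :
  (forall mu : probability (RI I R) R,
     (exists C : probability (RI I R) R, copula_measure C /\
        forall J : set I, finite_set J -> forall x : I -> R,
          cdfJ C J (fun j => cdf1 mu j (x j)) = cdfJ mu J x)
     /\
     ((forall i : I, continuous (cdf1 mu i : R -> R)) ->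
        forall C1 C2 : probability (RI I R) R,
          copula_measure C1 -> copula_measure C2 ->
          (forall J : set I, finite_set J -> forall x : I -> R,
             cdfJ C1 J (fun j => cdf1 mu j (x j)) = cdfJ mu J x) ->
          (forall J : set I, finite_set J -> forall x : I -> R,
             cdfJ C2 J (fun j => cdf1 mu j (x j)) = cdfJ mu J x) ->
          forall A : set (RI I R), measurable A -> C1 A = C2 A))
  /\
  (forall (C : probability (RI I R) R) (nu : I -> probability R R),
     copula_measure C ->
     (exists mu : probability (RI I R) R,
        forall J : set I, finite_set J -> forall x : I -> R,
          cdfJ C J (fun j => cdfR (nu j) (x j)) = cdfJ mu J x)
     /\
     (forall mu1 mu2 : probability (RI I R) R,
        (forall J : set I, finite_set J -> forall x : I -> R,
           cdfJ C J (fun j => cdfR (nu j) (x j)) = cdfJ mu1 J x) ->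
        (forall J : set I, finite_set J -> forall x : I -> R,
           cdfJ C J (fun j => cdfR (nu j) (x j)) = cdfJ mu2 J x) ->
        forall A : set (RI I R), measurable A -> mu1 A = mu2 A)).
Proof.
split => [mu|C nu copC]; split.
- exact: copula_exists.
- by move=> cF C1 C2; exact: copula_unique.
- exact: sklar_converse_exists.
- move=> mu1 mu2 H1 H2; apply: probability_eq_cdfJ => J fJ x.
  by rewrite -H1// -H2.
Qed.
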